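(* For any $\mathcal A$ cluster variety, there are no linear relations between cluster monomials and theta functions in $\nu(\operatorname{mid}(\mathcal A))\subset\operatorname{up}(\mathcal A)$. More precisely, if there is a (finite) linear relation $$\sum_{q\in\Theta(\mathcal A)}\alpha_q\vartheta_q=0$$ in $\operatorname{up}(\mathcal A)$ (with $\alpha_q\in\Bbbk$ and $\vartheta_q$ standing for $\nu(\vartheta_q)$), then $\alpha_q=0$ for all $q\in\Delta^+(\mathbb Z)$. In particular the cluster monomials in $\operatorname{ord}(\mathcal A_{prin})$ are linearly independent.
   Context: CONVENTIONS. $\Bbbk$ is a field of characteristic $0$; $[a]_+=\max(a,0)$; for a lattice $L$ with dual $L^*$, $T_L=\operatorname{Spec}\Bbbk[L^*]$ with characters $z^\ell$, $\ell\in L^*$. FIXED DATA $\Gamma$: a lattice $N$ of rank $n$ with a skew-symmetric form $\{\cdot,\cdot\}:N\times N\to\mathbb Q$; a saturated sublattice $N_{uf}\subseteq N$; $I=\{1,\dots,n\}\supseteq I_{uf}$ with $|I_{uf}|=\operatorname{rank}N_{uf}$; positive integers $d_i$ ($i\in I$) with gcd $1$; a finite-index sublattice $N^\circ\subseteq N$ with $\{N_{uf},N^\circ\}\subseteq\mathbb Z$ and $\{N,N_{uf}\cap N^\circ\}\subseteq\mathbb Z$. $M=\operatorname{Hom}(N,\mathbb Z)\subseteq M^\circ=\operatorname{Hom}(N^\circ,\mathbb Z)$. A seed is a basis $\mathbf s=(e_i)_{i\in I}$ of $N$ with $(e_i)_{i\in I_{uf}}$ a basis of $N_{uf}$ and $(d_ie_i)_{i\in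 I}$ a basis of $N^\circ$; $\epsilon_{ij}=\{e_i,e_j\}d_j$; $v_i=\{e_i,\cdot\}\in M^\circ$ for $i\in I_{uf}$, assumed non-zero; $p^*(n)=\{n,\cdot\}$ for $n\in N_{uf}$. Mutation at $k\in I_{uf}$: $\mu_k(\mathbf s)=(e_i')$, $e_k'=-e_k$, $e_i'=e_i+[\epsilon_{ik}]_+e_k$ for $i\neq k$. A mutation class of seeds is part of $\Gamma$; ''seed'' means a member of it. Put $\tilde N^\circ=N^\circ\oplus M$, $\tilde M^\circ=M^\circ\oplus N$. VARIETIES. $\mathcal A_{prin}=\bigcup T_{\tilde N^\circ,\mathbf s}$ is obtained by gluing copies of $T_{\tilde N^\circ}$, one for each seed obtained from an initial seed by a finite sequence of mutations, along the largest open sets on which the birational maps $\mu_k:T_{\tilde N^\circ,\mathbf s}\dashrightarrow T_{\tilde N^\circ,\mu_k(\mathbf s)}$, $\mu_k^*z^{(m,n)}=z^{(m,n)}(1+z^{(v_k,e_k)})^{-\langle d_ke_k,m\rangle}$, and their compositions are isomorphisms. $\pi:\mathcal A_{prin}\to T_M$ is defined by $\pi^*z^n=z^{(0,n)}$, and $\mathcal A=\pi^{-1}(e)=\bigcup T_{N^\circ,\mathbf s}$ is the fibre over the identity (glued by $\mu_k^*z^m=z^m(1+z^{v_k})^{-\langle d_ke_k,m\rangle}$). $\operatorname{up}(V)=\Gamma(V,\mathcal O_V)$. A cluster monomial on $\mathcal A$ (resp. $\mathcal A_{prin}$) is a regular function which on the torus of some seed $\mathbf s=(e_i)$ equals a character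 $z^m$ (resp. $z^{(m,n)}$) with $\langle e_i,m\rangle\ge0$ for all $i\in I_{uf}$; $\operatorname{ord}(V)\subset\operatorname{up}(V)$ is the subalgebra they generate. TROPICAL SETS. $\mathcal A^\vee(\mathbb Z^T)$ (resp. $\mathcal A_{prin}^\vee(\mathbb Z^T)$) is obtained from one copy of $M^\circ$ (resp. $\tilde M^\circ$) for each seed by identifying the copies for $\mathbf s$ and $\mu_k(\mathbf s)$ via $m\mapsto m+[\langle d_ke_k,m\rangle]_+v_k$ (resp. $(m,n)\mapsto(m,n)+[\langle d_ke_k,m\rangle]_+(v_k,e_k)$). $\rho^T:\mathcal A_{prin}^\vee(\mathbb Z^T)\to\mathcal A^\vee(\mathbb Z^T)$ is $(m,n)\mapsto m$. $\Delta^+(\mathbb Z)\subset\mathcal A^\vee(\mathbb Z^T)$ is the union over all seeds $\mathbf s$ of $\{m\in M^\circ:\langle e_i,m\rangle\ge0\ \forall i\in I_{uf}\}$ (the set of $g$-vectors of cluster monomials). SCATTERING DIAGRAM. Fix a seed $\mathbf s$. $N^+=\{\sum_{i\in I_{uf}}a_ie_i: a_i\in\mathbb Z_{\ge0},\sum a_i>0\}$, $\deg\sum a_ie_i=\sum a_i$. A wall is $(\mathfrak d,f)$ with $\mathfrak d\subset(n_0,0)^\perp\subset\tilde M^\circ_{\mathbb R}$ a codimension-one convex rational polyhedral cone, $n_0\in N^+$ primitive, $f=1+\sum_{j\ge1}c_jz^{j(p^*(n_0),n_0)}$. A scattering diagram is a set of walls such that for each $k$ only finitely many have some $c_j\ne0$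 with $\deg(jn_0)\le k$; support: union of walls; singular locus: boundaries of walls and codimension-two intersections. Crossing a wall along $\gamma$ gives $z^x\mapsto z^xf^{\varepsilon\langle n_0',x\rangle}$, $n_0'$ the primitive generator of $\mathbb R_{\ge0}(n_0,0)\cap\tilde N^\circ$, $\varepsilon=-\operatorname{sgn}\langle(n_0,0),\gamma'\rangle$; consistent means that the composed automorphism of a path (on the completion $\widehat{\Bbbk[P]}$, $P$ the lattice points of a strictly convex cone containing all $(v_i,e_i)$) depends only on endpoints; equivalent means same path automorphisms; a wall is incoming if $(p^*(n_0),n_0)\in\mathfrak d$, else outgoing. $\mathfrak D_{\mathbf s}$ is the consistent diagram, unique up to equivalence, containing $((e_i,0)^\perp,1+z^{(v_i,e_i)})$, $i\in I_{uf}$, all other walls outgoing. $\mathcal C^+_{\mathbf s}=\{(m,n):\langle e_i,m\rangle\ge0\ \forall i\in I_{uf}\}$. THETA FUNCTIONS. A broken line with initial exponent $m_0\in\tilde M^\circ\setminus\{0\}$ and endpoint $Q$ (outside the support) is a continuous proper piecewise linear path $\gamma:(-\infty,0]\to\tilde M^\circ_{\mathbb R}$ avoiding the singular locus, with finitely many domains of linearity $L$ carrying monomials $c_Lz^{m_L}$, such that $\gamma(0)=Q$; the first monomial is $z^{m_0}$; $\gamma'=-m_L$ on $L$; and when $\gamma$ bends at time $t$ from $L$ to $L'$, $c_{L'}z^{m_{L'}}$ is a term of $c_Lz^{m_L}\prod_{\mathfrak d\ni\gamma(t)}f_{\mathfrak d}^{\langle n_0',m_L\rangle}$ with $n_0'\in\tilde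 N^\circ$ primitive, vanishing on these walls, $\langle n_0',m_L\rangle>0$. $\vartheta_{Q,m_0}$ is the sum of the final monomials over all such broken lines; $\vartheta_{Q,0}=1$. $\Theta(\mathcal A_{prin})$ is the set of $q\in\mathcal A_{prin}^\vee(\mathbb Z^T)$ such that for some (equivalently every) seed and general $Q\in\operatorname{Int}\mathcal C^+_{\mathbf s}$ there are only finitely many broken lines with initial exponent $q$ and endpoint $Q$; for such $q$ there is a function in $\operatorname{up}(\mathcal A_{prin})$ restricting to $\vartheta_{Q,q}$ on the torus of each seed. $\Theta(\mathcal A)=\rho^T(\Theta(\mathcal A_{prin}))$; for $q\in\Theta(\mathcal A)$, $\nu(\vartheta_q)\in\operatorname{up}(\mathcal A)$ is the restriction to $\mathcal A=\pi^{-1}(e)$ of the function of any $\tilde q\in\Theta(\mathcal A_{prin})$ with $\rho^T(\tilde q)=q$. $\operatorname{mid}(\mathcal A)=\bigoplus_{q\in\Theta(\mathcal A)}\Bbbk\vartheta_q$. *)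

(* Defs.v *)
From HB Require Import structures.
From mathcomp Require Import all_boot all_order all_algebra fraction finmap.
From mathcomp Require Import -(notations) mpoly.
From mathcomp Require Import all_classical all_reals all_analysis.

Set Implicit Arguments.
Unset Strict Implicit.
Unset Printing Implicit Defensive.

Import Order.TTheory GRing.Theory Num.Theory.
Local Open Scope classical_set_scope.
Local Open Scope ring_scope.

(* Lattices.  N is Z^n (row vectors), and the finite-index sublattice N° is
   given by an arbitrary Z-basis, the rows of [Nob].  Elements of
   M° = Hom(N°, Z) are row vectors of coordinates in the basis dual to [Nob]:
   the j-th entry of m is <row j Nob, m>.  Elements of \tilde M° = M° (+) N and
   of \tilde M°_R are concatenations [row_mx m x]. *)
Record cluster_data := ClusterData {
  rk : nat;
  skew : 'M[rat]_rk;             (* Gram matrix of {.,.} on N *)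
  Nuf : set 'rV[int]_rk;
  uf : {set 'I_rk};
  dd : 'I_rk -> nat;
  Nob : 'M[int]_rk;
  seed0 : 'M[int]_rk             (* initial seed: the rows are the e_i *)
}.
Arguments Nuf : clear implicits.
Arguments dd : clear implicits.

Section Lattices.
Variable G : cluster_data.
Let n := rk G.

Definition form (x y : 'rV[int]_n) : rat :=
  (map_mx intr x *m skew G *m (map_mx intr y)^T) 0 0.

Definition Nopen : set 'rV[int]_n := [set y *m Nob G | y in setT].

(* <x, m> for x in N and m in M° (x) F. *)
Definition pairing (F : comUnitRingType) (x : 'rV[int]_n) (m : 'rV[F]_n) : F :=
  (map_mx intr x *m invmx (map_mx intr (Nob G)) *m m^T) 0 0.

(* p^*(x) = {x, .} for x in N_uf.  The entries are integers by [int_uf_open],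
   and [numq] reads an integral rational as an integer. *)
Definition pstar (x : 'rV[int]_n) : 'rV[int]_n :=
  \row_j numq (form x (row j (Nob G))).

(* The vector (p^*(x), x) of \tilde M°. *)
Definition pvec (x : 'rV[int]_n) : 'rV[int]_(n + n) := row_mx (pstar x) x.

Record is_seed (s : 'M[int]_n) : Prop := IsSeed {
  seed_basis : s \in unitmx;
  seed_uf : forall x, Nuf G x <->
    exists2 a : 'rV[int]_n, (forall i, i \notin uf G -> a 0 i = 0) & x = a *m s;
  seed_open : exists2 U : 'M[int]_n, U \in unitmx &
    (\matrix_i ((dd G i)%:Z *: row i s)) = U *m Nob G;
  seed_v : forall i, i \in uf G -> pstar (row i s) != 0
}.

(* The equality |I_uf| = rank N_uf is part of [seed_uf] for [seed0]. *)
Record is_fixed_data : Prop := IsFixedData {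
  skew_skew : (skew G)^T = - skew G;
  Nuf_sub0 : Nuf G 0;
  Nuf_subB : forall x y, Nuf G x -> Nuf G y -> Nuf G (x - y);
  Nuf_saturated : forall (a : int) x, a != 0 -> Nuf G (a *: x) -> Nuf G x;
  dd_gt0 : forall i, (0 < dd G i)%N;
  dd_gcd : \big[gcdn/0%N]_i dd G i = 1%N;
  Nob_index : \det (Nob G) != 0;
  int_uf_open : forall x y, Nuf G x -> Nopen y -> form x y \is a Num.int;
  int_all_ufopen : forall x y, Nuf G y -> Nopen y -> form x y \is a Num.int;
  seed0_seed : is_seed (seed0 G)
}.

Definition eps (s : 'M[int]_n) (i k : 'I_n) : int :=
  numq (form (row i s) (row k s) * (dd G k)%:R).

Definition mutate (s : 'M[int]_n) (k : 'I_n) : 'M[int]_n :=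
  \matrix_i (if i == k then - row k s
             else row i s + Num.max (eps s i k) 0 *: row k s).

Definition vvec (s : 'M[int]_n) (k : 'I_n) : 'rV[int]_n := pstar (row k s).
Definition vevec (s : 'M[int]_n) (k : 'I_n) : 'rV[int]_(n + n) :=
  pvec (row k s).

(* <d_k e_k, m>, an integer because d_k e_k lies in N°. *)
Definition dpair (s : 'M[int]_n) (k : 'I_n) (m : 'rV[int]_n) : int :=
  numq ((dd G k)%:R * pairing (row k s) (map_mx intr m)).

(* The copies of the torus are indexed by finite sequences of mutations
   starting at the initial seed, i.e. by the vertices of the rooted tree of
   mutations.  Two sequences may lead to the same basis of N while the
   corresponding birational maps differ, so the basis alone cannot serve as
   the index. *)
Definition vertex := seq {i : 'I_n | i \in uf G}.

Definition seed_at (w : vertex) : 'M[int]_n :=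
  foldl (fun s k => mutate s (val k)) (seed0 G) w.

(* Cone C^+_s: lattice points for A and A_prin. *)
Definition chamber (s : 'M[int]_n) : set 'rV[int]_n :=
  [set m | forall i, i \in uf G ->
     0 <= pairing (row i s) (map_mx intr m : 'rV[rat]_n)].

(* Tropical sets.  All identifications are bijections along a tree, so a point
   of the glued set is given by its representative in the copy attached to the
   initial seed; [trop] and [tropP] compute the representative in the copy
   attached to a vertex. *)
Definition trop_mut (s : 'M[int]_n) (k : 'I_n) (m : 'rV[int]_n) :=
  m + Num.max (dpair s k m) 0 *: vvec s k.
Definition tropP_mut (s : 'M[int]_n) (k : 'I_n) (x : 'rV[int]_(n + n)) :=
  x + Num.max (dpair s k (lsubmx x)) 0 *: vevec s k.

Fixpoint trop_from (s : 'M[int]_n) (w : vertex) (m : 'rV[int]_n) :=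
  if w is k :: w' then trop_from (mutate s (val k)) w' (trop_mut s (val k) m)
  else m.
Fixpoint tropP_from (s : 'M[int]_n) (w : vertex) (x : 'rV[int]_(n + n)) :=
  if w is k :: w' then tropP_from (mutate s (val k)) w' (tropP_mut s (val k) x)
  else x.

Definition trop (w : vertex) (m : 'rV[int]_n) := trop_from (seed0 G) w m.
Definition tropP (w : vertex) (x : 'rV[int]_(n + n)) := tropP_from (seed0 G) w x.

Definition rhoT (x : 'rV[int]_(n + n)) : 'rV[int]_n := lsubmx x.

Definition DeltaPlus : set 'rV[int]_n :=
  [set m | exists w : vertex, chamber (seed_at w) (trop w m)].

Definition Nplus (s : 'M[int]_n) : set 'rV[int]_n :=
  [set x | let a := x *m invmx s in
     [/\ forall i, 0 <= a 0 i, forall i, i \notin uf G -> a 0 i = 0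
       & 0 < \sum_i a 0 i]].

Definition degN (s : 'M[int]_n) (x : 'rV[int]_n) : int :=
  \sum_i (x *m invmx s) 0 i.

Definition primitive (x : 'rV[int]_n) : Prop :=
  forall (a : int) y, x = a *: y -> `|a| = 1.

(* For x in N primitive, [openmult x *: x] is the primitive generator of
   R_{>=0} x \cap N°: the least positive c such that the coordinates of c x in
   the basis [Nob] are integers. *)
Definition openmult (x : 'rV[int]_n) : nat :=
  \big[lcmn/1%N]_j
    absz (denq ((map_mx intr x *m invmx (map_mx intr (Nob G))) 0 j)).

(* <n_0', y> for n_0' = (openmult x *: x, 0) and y in \tilde M°. *)
Definition npair (x : 'rV[int]_n) (y : 'rV[int]_(n + n)) : int :=
  numq ((openmult x)%:R * pairing x (map_mx intr (lsubmx y))).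

End Lattices.
Arguments DeltaPlus : clear implicits.

Section Functions.
Variables (k : fieldType) (G : cluster_data).
Let n := rk G.

(* Regular functions on a torus with character lattice Z^m, as finitely
   supported families of coefficients on characters. *)
Definition laurent (m : nat) := {fsfun 'rV[int]_m -> k with 0}.

Definition ratfun (m : nat) : fieldType := {fraction (mpoly m k)}.

Definition character (m : nat) (x : 'rV[int]_m) : ratfun m :=
  \prod_(i < m) (tofrac (mpolyX k (mnm1 i) : mpoly m k)) ^ (x 0 i).

(* k-linear extension of a map defined on characters. *)
Definition lineval (m : nat) (phi : 'rV[int]_m -> ratfun m) (f : laurent m) :
    ratfun m :=
  \sum_(x <- finsupp f) tofrac (mpolyC m (f x) : mpoly m k) * phi x.

(* mu_k^* z^{(m,n)} in the function field of the torus of s. *)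
Definition mut_character (s : 'M[int]_n) (j : 'I_n) (x : 'rV[int]_(n + n)) :
    ratfun (n + n) :=
  character x * (1 + character (vevec s j)) ^ (- dpair s j (lsubmx x)).

Definition torus_family := vertex G -> laurent (n + n).

(* up(A_prin): a global function is a family of regular functions on the tori
   that correspond to each other, as rational functions, under every mutation.
   (The overlaps of the gluing are dense open subsets of the tori.) *)
Definition up_prin (F : torus_family) : Prop :=
  forall (w : vertex G) (j : {i : 'I_n | i \in uf G}),
    lineval (@character (n + n)) (F w) =
    lineval (mut_character (seed_at w) (val j)) (F (rcons w j)).

(* Restriction to the fibre A = pi^{-1}(e), where z^{(0,x)} = 1: the coefficient
   of z^m on each torus of A.  The tori cover A, so an element of up(A) is zero
   iff all these coefficients are. *)
Definition resA (F : torus_family) (w : vertex G) (m : 'rV[int]_n) : k :=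
  \sum_(x <- finsupp (F w) | lsubmx x == m) F w x.

Definition cluster_monomial_prin (F : torus_family) : Prop :=
  up_prin F /\
  exists (w : vertex G) (x : 'rV[int]_(n + n)),
    chamber (seed_at w) (lsubmx x) /\ forall y, F w y = (y == x)%:R.

End Functions.

(* A wall (d, f): the primitive normal n_0 in N^+, the cone d, and the
   coefficients c_j of f = sum_j c_j z^{j (p^*(n_0), n_0)}. *)
Record wall (k : fieldType) (R : realType) (m : nat) := Wall {
  wnormal : 'rV[int]_m;
  wcone : set 'rV[R]_(m + m);
  wcoef : nat -> k
}.

HB.instance Definition _ k R m := gen_eqMixin (@wall k R m).
HB.instance Definition _ k R m := gen_choiceMixin (@wall k R m).

Section Scattering.
Variables (k : fieldType) (R : realType) (G : cluster_data).
Let n := rk G.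
Local Notation V := 'rV[R]_(n + n).
Local Notation wallt := (wall k R n).

Definition hyperplane (x : 'rV[int]_n) : set V :=
  [set p | pairing x (lsubmx p) = 0].

(* Rational convex polyhedral cone of dimension 2n - 1. *)
Definition is_codim1_cone (C : set V) : Prop :=
  exists (r : nat) (g : 'M[int]_(r, n + n)),
    (\rank (map_mx intr g : 'M[R]_(r, n + n))).+1 = (n + n)%N /\
    C = [set p | exists2 a : 'rV[R]_r,
                   (forall i, 0 <= a 0 i) & p = a *m map_mx intr g].

Record is_wall (s : 'M[int]_n) (W : wallt) : Prop := IsWall {
  wall_Nplus : Nplus s (wnormal W);
  wall_prim : primitive (wnormal W);
  wall_cone : is_codim1_cone (wcone W);
  wall_perp : wcone W `<=` hyperplane (wnormal W);
  wall_coef0 : wcoef W 0%N = 1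
}.

(* f has a term c_j <> 0 with deg (j n_0) <= d. *)
Definition visible (s : 'M[int]_n) (d : nat) (W : wallt) : Prop :=
  exists j : nat, [/\ (0 < j)%N, wcoef W j != 0
                    & degN s (wnormal W *+ j) <= d%:Z].

Definition is_scattering (s : 'M[int]_n) (D : set wallt) : Prop :=
  (forall W, D W -> is_wall s W) /\
  (forall d, finite_set [set W | D W /\ visible s d W]).

Definition support (D : set wallt) : set V :=
  [set p | exists2 W, D W & wcone W p].

(* Boundary of a wall relative to the hyperplane it spans. *)
Definition wboundary (W : wallt) : set V :=
  [set p | wcone W p /\
     ~ (exists2 r : R, 0 < r &
          forall q, hyperplane (wnormal W) q ->
            (forall i, `|q 0 i - p 0 i| < r) -> wcone W q)].

(* The linear span of C has dimension d. *)
Definition has_dim (C : set V) (d : nat) : Prop :=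
  (exists2 g : 'M[R]_(d, n + n), row_free g & forall i, C (row i g)) /\
  ~ (exists2 g : 'M[R]_(d.+1, n + n), row_free g & forall i, C (row i g)).

Definition singular (D : set wallt) : set V :=
  [set p | (exists2 W, D W & wboundary W p) \/
     (exists W W' d, [/\ D W, D W', d.+2 = (n + n)%N,
        has_dim (wcone W `&` wcone W') d & (wcone W `&` wcone W') p])].

(* The j-th coefficient of f^e, for f = sum_i c_i t^i with c_0 = 1.  Modulo
   t^(j+1), the inverse of f is sum_(i <= j) (1 - f)^i. *)
Definition series_pow (c : nat -> k) (e : int) (j : nat) : k :=
  let f := \poly_(i < j.+1) c i in
  match e with
  | Posz a => (f ^+ a)`_j
  | Negz a => ((\sum_(i < j.+1) (1 - f) ^+ i) ^+ a.+1)`_j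
  end.

(* z^x |-> z^x f^(sg <n_0', x>), extended linearly to coefficient functions on
   \tilde M°; terms of f of index > d are dropped, since they only contribute
   in relative degree > d. *)
Definition cross (d : nat) (W : wallt) (sg : int)
    (h : 'rV[int]_(n + n) -> k) : 'rV[int]_(n + n) -> k :=
  fun y => \sum_(j < d.+1)
    let x := y - pvec (wnormal W) *+ j in
    h x * series_pow (wcoef W) (sg * npair (wnormal W) x) j.

Definition nheight (x : 'rV[int]_n) (g : R -> V) (t : R) : R :=
  pairing x (lsubmx (g t)).

(* Smooth paths [0,1] -> \tilde M°_R (as restrictions of paths on R) avoiding
   the singular locus, with endpoints off the support, transversal to walls. *)
Record admissible_path (D : set wallt) (g : R -> V) : Prop := AdmissiblePath {
  path_smooth : forall i (j : nat) (t : R),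
    derivable (derive1n j (fun u => g u 0 i)) t 1;
  path_nonsing : forall t, 0 <= t <= 1 -> ~ singular D (g t);
  path_start : ~ support D (g 0);
  path_end : ~ support D (g 1);
  path_transv : forall t W, 0 <= t <= 1 -> D W -> wcone W (g t) ->
    derive1 (nheight (wnormal W) g) t != 0
}.

(* The list, in order of crossing, of the crossings of g with the walls of D
   that are non-trivial up to degree d. *)
Definition crossings (s : 'M[int]_n) (D : set wallt) (g : R -> V) (d : nat)
    (l : seq (R * wallt)) : Prop :=
  [/\ uniq l, sorted (fun a b : R * wallt => a.1 <= b.1) l
    & forall t W, (t, W) \in l <->
        [/\ 0 <= t <= 1, D W, visible s d W & wcone W (g t)]].

Definition cross_all (g : R -> V) (d : nat) (l : seq (R * wallt))
    (h : 'rV[int]_(n + n) -> k) : 'rV[int]_(n + n) -> k :=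
  foldl (fun h' a =>
           cross d a.2 (- sgz (derive1 (nheight (wnormal a.2) g) a.1)) h') h l.

(* The images of every z^x under the path automorphisms agree modulo terms
   z^y with y - x = (p^*(a), a), deg a > d, for every d. *)
Definition consistent (s : 'M[int]_n) (D : set wallt) : Prop :=
  forall g g' : R -> V, admissible_path D g -> admissible_path D g' ->
    g 0 = g' 0 -> g 1 = g' 1 ->
  forall d l l', crossings s D g d l -> crossings s D g' d l' ->
  forall x y : 'rV[int]_(n + n), degN s (rsubmx (y - x)) <= d%:Z ->
    cross_all g d l (fun u => (u == x)%:R) y =
    cross_all g' d l' (fun u => (u == x)%:R) y.

Definition incoming (W : wallt) : Prop :=
  wcone W (map_mx intr (pvec (wnormal W))).

(* ((e_i,0)^perp, 1 + z^(v_i,e_i)) *)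
Definition initial_wall (s : 'M[int]_n) (i : 'I_n) : wallt :=
  Wall (row i s) (hyperplane (row i s)) (fun j => (j <= 1)%N%:R).

(* D is (a representative of the equivalence class of) D_s. *)
Record is_cluster_diagram (s : 'M[int]_n) (D : set wallt) : Prop :=
  IsClusterDiagram {
    diag_scat : is_scattering s D;
    diag_cons : consistent s D;
    diag_init : forall i, i \in uf G -> D (initial_wall s i);
    diag_out : forall W, D W ->
      (exists2 i, i \in uf G & W = initial_wall s i) \/ ~ incoming W
  }.

(* A broken line is encoded by the list of its domains of linearity: the
   triple (t, c, m) stands for the domain that ends at time t and carries
   c z^m.  The first domain starts at -oo, the last one ends at 0. *)
Definition bline := seq (R * k * 'rV[int]_(n + n)).

Definition btime (b : bline) i := (nth (0, 0, 0) b i).1.1.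
Definition bcoef (b : bline) i := (nth (0, 0, 0) b i).1.2.
Definition bexp (b : bline) i := (nth (0, 0, 0) b i).2.

Definition walls_at (D : set wallt) (p : V) : set wallt :=
  [set W | D W /\ wcone W p].

(* (c', m') is obtained from (c, m) by bending at p.  The walls through p share
   the normal n_0, and the exponent <n_0', m> > 0 of the rule is |<n_0', m>|
   for the generator n_0' with the sign of n_0.  Only the finitely many walls
   with a non-zero c_i, 0 < i <= j, affect the coefficient of index j. *)
Definition bends (D : set wallt) (p : V) (c : k) (m : 'rV[int]_(n + n))
    (c' : k) (m' : 'rV[int]_(n + n)) : Prop :=
  exists (x : 'rV[int]_n) (j : nat),
    let e := `|npair x m|%N in
    let a := (\big[*%R/1]_(W \in walls_at D p)
                (\poly_(i < j.+1) wcoef W i) ^+ e)`_j in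
    [/\ walls_at D p !=set0, forall W, walls_at D p W -> wnormal W = x,
        (0 < e)%N /\ (0 < j)%N
      & [/\ a != 0, c' = c * a & m' = m + pvec x *+ j]].

(* Properness of the path amounts to m0 != 0. *)
Definition is_broken_line (D : set wallt) (m0 : 'rV[int]_(n + n)) (Q : V)
    (b : bline) : Prop :=
  [/\ m0 != 0, ~ support D Q,
      (0 < size b)%N /\ sorted (fun u v : R * k * 'rV[int]_(n + n) =>
                                  u.1.1 < v.1.1) b,
      [/\ btime b (size b).-1 = 0, bcoef b 0 = 1 & bexp b 0 = m0] &
      exists g : R -> V,
      [/\ g 0 = Q,
          forall i t, (i < size b)%N ->
            (0 < i)%N ==> (btime b i.-1 <= t) -> t <= btime b i ->
            g t = g (btime b i) + (btime b i - t) *: map_mx intr (bexp b i),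
          forall t, t <= 0 -> ~ singular D (g t) &
          forall i, (i.+1 < size b)%N ->
            bends D (g (btime b i)) (bcoef b i) (bexp b i)
                                    (bcoef b i.+1) (bexp b i.+1)]].

Definition broken_lines (D : set wallt) (m0 : 'rV[int]_(n + n)) (Q : V) :
  set bline := is_broken_line D m0 Q.

(* Coefficient of z^x in vartheta_{Q,m0}, meaningful when there are finitely
   many broken lines. *)
Definition theta_at (D : set wallt) (Q : V) (m0 x : 'rV[int]_(n + n)) : k :=
  if m0 == 0 then (x == 0)%:R else
  \sum_(b \in [set b | broken_lines D m0 Q b /\ bexp b (size b).-1 = x])
    bcoef b (size b).-1.

(* General points: those on no rational hyperplane. *)
Definition general (Q : V) : Prop :=
  forall a : 'rV[int]_(n + n), a != 0 -> \sum_i (a 0 i)%:~R * Q 0 i != 0.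

Definition int_chamber (s : 'M[int]_n) : set V :=
  [set Q | forall i, i \in uf G -> 0 < pairing (row i s) (lsubmx Q)].

Variable D : vertex G -> set wallt.

Definition Theta_prin : set 'rV[int]_(n + n) :=
  [set q | exists w, forall Q, general Q -> int_chamber (seed_at w) Q ->
             finite_set (broken_lines (D w) (tropP w q) Q)].

Definition Theta_A : set 'rV[int]_n := [set rhoT q | q in Theta_prin].

(* F in up(A_prin) restricts to vartheta_{Q,q} on the torus of each seed. *)
Definition is_theta (q : 'rV[int]_(n + n)) (F : torus_family k G) : Prop :=
  up_prin F /\
  forall w Q, general Q -> int_chamber (seed_at w) Q ->
    finite_set (broken_lines (D w) (tropP w q) Q) /\
    forall x, F w x = theta_at (D w) Q (tropP w q) x.

End Scattering.

(* Main.v *)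
(**
Walls of the scattering diagram of a seed s lie in hyperplanes n_0^perp with
n_0 in N^+, so they miss the interior of the chamber C^+_s; fix Q there.

A broken line ending at Q whose final exponent m lies in C^+_s follows the ray
Q + t m backwards in time, never meets a wall, and is therefore straight.
Hence, on the torus of s, the coefficient of z^m (m in the chamber) in theta_q
is 1 if q corresponds to m and 0 otherwise; this survives restriction to the
fibre A because the chamber only depends on the M°-component.  Reading a linear
relation at this coefficient isolates alpha_q.

A broken line whose initial exponent m_0 lies in C^+_s is straight as well: if
m_i = m_0 + (p^*(N_i), N_i) are its exponents, then <N_i, gamma(t)> starts at 0
and is continuous and non-increasing because {N_i, N_i} = 0, while
<N, Q> > 0 for every N in N^+.  So a cluster monomial with g-vector q agrees
with theta_q on one torus, hence everywhere since mutations are injective on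
Laurent polynomials, and the coefficient argument applies again.
*)

Require Import Defs.
From mathcomp Require Import all_boot all_order all_algebra fraction finmap.
From mathcomp Require Import -(notations) mpoly.
From mathcomp Require Import all_classical all_reals all_analysis.
(* mathcomp's [form] and [skew] shadow those of [Defs]. *)
Import Defs.

Set Implicit Arguments.
Unset Strict Implicit.
Unset Printing Implicit Defensive.

Import Order.TTheory GRing.Theory Num.Theory.
Local Open Scope classical_set_scope.
Local Open Scope ring_scope.

(** * Bilinearity of the pairing between N and M° *)

Section Pairing.
Context {G : cluster_data} {F : comUnitRingType}.
Implicit Types (x y : 'rV[int]_(rk G)) (m p : 'rV[F]_(rk G)).

Lemma pairing0l m : pairing (G := G) 0 m = 0.
Proof. by rewrite /pairing map_mx0 !mul0mx mxE. Qed.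

Lemma pairingDl x y m : pairing (x + y) m = pairing x m + pairing y m.
Proof. by rewrite /pairing map_mxD !mulmxDl mxE. Qed.

Lemma pairingZl (c : int) x m : pairing (c *: x) m = c%:~R * pairing x m.
Proof. by rewrite /pairing map_mxZ -!scalemxAl mxE. Qed.

Lemma pairingMnl x m j : pairing (x *+ j) m = pairing x m *+ j.
Proof.
elim: j => [|j IH]; first by rewrite !mulr0n pairing0l.
by rewrite !mulrSr pairingDl IH.
Qed.

Lemma pairingDr x m p : pairing x (m + p) = pairing x m + pairing x p.
Proof. by rewrite /pairing linearD /= mulmxDr mxE. Qed.

Lemma pairingZr (c : F) x m : pairing x (c *: m) = c * pairing x m.
Proof. by rewrite /pairing linearZ /= -scalemxAr mxE. Qed.

Lemma pairing_mulmx (a : 'rV[int]_(rk G)) (s : 'M[int]_(rk G)) m :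
  pairing (a *m s) m = \sum_i (a 0 i)%:~R * pairing (row i s) m.
Proof.
rewrite /pairing map_mxM -!mulmxA mxE; apply: eq_bigr => i _.
by rewrite [in LHS]mxE map_row -mulmxA -row_mul [in RHS]mxE.
Qed.

End Pairing.

(** Chambers are defined over the rationals while broken lines move in a real space; this carries
    signs from one to the other. *)
Lemma pairing_ratr (G : cluster_data) (F : numFieldType) (x m : 'rV[int]_(rk G)) :
  pairing x (map_mx intr m : 'rV[F]_(rk G)) =
  ratr (pairing x (map_mx intr m : 'rV[rat]_(rk G))).
Proof.
have h p q (A : 'M[int]_(p, q)) :
    map_mx ratr (map_mx intr A : 'M[rat]_(p, q)) = map_mx intr A :> 'M[F]_(p, q).
  by apply/matrixP => i j; rewrite !mxE ratr_int.
rewrite /pairing -!h -map_invmx map_trmx -!map_mxM mxE //.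
Qed.

Lemma trmx00 (T : Type) (A : 'M[T]_1) : A^T 0 0 = A 0 0.
Proof. by rewrite mxE. Qed.

(** * The skew form, the sublattices N_uf and N°, and p^* *)

Section FixedData.
Context {G : cluster_data} (hG : is_fixed_data G).
Local Notation n := (rk G).
Implicit Types (x y z : 'rV[int]_n) (s : 'M[int]_n).

Lemma formZr (c : int) x y : form x (c *: y) = c%:~R * form x y.
Proof. by rewrite /form map_mxZ linearZ /= -scalemxAr mxE. Qed.

Lemma formC x y : form x y = - form y x.
Proof.
rewrite /form -[LHS]trmx00 !trmx_mul trmxK skew_skew //.
by rewrite mulNmx mulmxN mxE mulmxA.
Qed.

Lemma form_xx x : form x x = 0.
Proof.
have /eqP := formC x x.
by rewrite -addr_eq0 -mulr2n mulrn_eq0 => /eqP.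
Qed.

Lemma row_Nopen i : @Nopen G (row i (Nob G)).
Proof. by exists (delta_mx 0 i); rewrite // -rowE. Qed.

Lemma NufD x y : Nuf G x -> Nuf G y -> Nuf G (x + y).
Proof.
move=> hx hy; rewrite -[y]opprK; apply: Nuf_subB => //.
by rewrite -sub0r; apply: Nuf_subB => //; exact: Nuf_sub0.
Qed.

Lemma NufMn x j : Nuf G x -> Nuf G (x *+ j).
Proof.
move=> hx; elim: j => [|j IH]; first by rewrite mulr0n; apply: Nuf_sub0.
by rewrite mulrSr; apply: NufD.
Qed.

Lemma NufZ (c : int) x : Nuf G x -> Nuf G (c *: x).
Proof.
move=> hx; rewrite -[c]intz scaler_int; case: c => j; first exact: NufMn.
by rewrite NegzE mulrNz -sub0r; apply: Nuf_subB => //; [apply: Nuf_sub0|apply: NufMn].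
Qed.

Lemma NopenD x y : @Nopen G x -> @Nopen G y -> @Nopen G (x + y).
Proof. by move=> [a _ <-] [b _ <-]; exists (a + b); rewrite ?mulmxDl. Qed.

Lemma NopenZ (c : int) x : @Nopen G x -> @Nopen G (c *: x).
Proof. by move=> [a _ <-]; exists (c *: a); rewrite ?scalemxAl. Qed.

Lemma Nob_unit (F : numFieldType) : map_mx intr (Nob G) \in @unitmx F n.
Proof. by rewrite unitmxE det_map_mx unitfE intr_eq0; apply: Nob_index. Qed.

Lemma map_pstar x : Nuf G x ->
  map_mx intr (pstar x) = map_mx intr x *m skew G *m (map_mx intr (Nob G))^T.
Proof.
move=> hx; apply/rowP => j; rewrite !mxE.
have -> : (numq (form x (row j (Nob G))))%:~R = form x (row j (Nob G)).
  by rewrite numqK //; apply: int_uf_open => //; apply: row_Nopen.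
by rewrite /form mxE; apply: eq_bigr => l _; rewrite !mxE.
Qed.

(** The inverse of [Nob] inside [pairing] cancels the [Nob] inside [pstar]. *)
Lemma pairing_pstar x y : Nuf G y ->
  pairing x (map_mx intr (pstar y) : 'rV[rat]_n) = form y x.
Proof.
move=> hy; rewrite /pairing map_pstar // !trmx_mul trmxK !mulmxA mulmxKV ?Nob_unit //.
by rewrite /form -[RHS]trmx00 !trmx_mul trmxK mulmxA.
Qed.

(** Membership in N_uf makes all form values integral, and on integral rationals [numq] is
    additive. *)
Lemma pstarD x y : Nuf G x -> Nuf G y -> pstar (x + y) = pstar x + pstar y.
Proof.
move=> hx hy.
have inj (u v : 'rV[int]_n) : map_mx (intr : int -> rat) u = map_mx intr v -> u = v.
  by move=> /rowP uv; apply/rowP => i; have := uv i; rewrite !mxE => /intr_inj.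
apply: inj; rewrite map_mxD !map_pstar ?map_mxD ?mulmxDl //; exact: NufD.
Qed.

Lemma pvecD x y : Nuf G x -> Nuf G y -> pvec (x + y) = pvec x + pvec y.
Proof. by move=> hx hy; rewrite /pvec pstarD // add_row_mx. Qed.

Lemma pvec0 : pvec 0 = 0 :> 'rV[int]_(n + n).
Proof.
have h := Nuf_sub0 hG.
by apply: (addrI (pvec 0)); rewrite -pvecD // !addr0.
Qed.

Lemma pvecMn x j : Nuf G x -> pvec (x *+ j) = pvec x *+ j.
Proof.
move=> hx; elim: j => [|j IH]; first by rewrite !mulr0n pvec0.
by rewrite !mulrSr pvecD ?IH //; exact: NufMn.
Qed.

(** By skew-symmetry {x, x} = 0, so bending adds to the exponent a vector parallel to the wall. *)
Lemma pairing_pvec (F : numFieldType) x : Nuf G x ->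
  pairing x (map_mx intr (lsubmx (pvec x)) : 'rV[F]_n) = 0.
Proof.
by move=> hx; rewrite row_mxKl pairing_ratr pairing_pstar // form_xx // raddf0.
Qed.

End FixedData.

(** * Stability of seeds under mutation; bijectivity of tropical mutations *)

Section Seeds.
Context {G : cluster_data} (hG : is_fixed_data G).
Local Notation n := (rk G).
Implicit Types (x y : 'rV[int]_n) (s : 'M[int]_n) (i j : 'I_n).

(* Weaker than [is_seed] ([seed_uf] in one direction only, no [seed_v]), so
   that stability under mutation is easy. *)
Definition seed_like s : Prop :=
  [/\ s \in unitmx, forall i, i \in uf G -> Nuf G (row i s)
    & forall i, Nopen (G := G) ((dd G i)%:Z *: row i s)].

Lemma seed_like0 : seed_like (seed0 G).
Proof.
have [hu huf [U _ hU] _] := seed0_seed hG; split=> // i.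
  move=> iuf; apply/huf; exists (delta_mx 0 i); last by rewrite -rowE.
  move=> j juf; rewrite mxE eqxx /=; case: eqP => // ji.
  by rewrite -ji (negPf juf) in iuf.
exists (row i U) => //; rewrite -row_mul -hU.
by apply/rowP => j; rewrite !mxE.
Qed.

Lemma mutate_unit s k : s \in unitmx -> mutate (G := G) s k \in unitmx.
Proof.
pose c i := Num.max (eps (G := G) s i k) 0.
(* The inverse change of basis: e_k = - e_k' and e_i = e_i' + c_i e_k'. *)
pose E : 'M[int]_n := \matrix_i (if i == k then - delta_mx 0 k
                                else delta_mx 0 i + c i *: delta_mx 0 k).
suff hE : E *m mutate (G := G) s k = s.
  by rewrite -{1}hE unitmx_mul => /andP[].
apply/row_matrixP => i; rewrite row_mul rowK; case: eqP => [->|/eqP ik].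
  by rewrite mulNmx -rowE rowK eqxx opprK.
by rewrite mulmxDl -scalemxAl -!rowE !rowK eqxx (negPf ik) scalerN addrK.
Qed.

Lemma seed_like_mutate s k : k \in uf G -> seed_like s ->
  seed_like (mutate (G := G) s k).
Proof.
move=> kuf [hu huf ho]; split; first exact: mutate_unit.
  move=> i iuf; rewrite rowK; case: eqP => _.
    by rewrite -scaleN1r; apply: NufZ => //; apply: huf.
  by apply: NufD; [exact: hG | exact: huf | apply: NufZ => //; apply: huf].
move=> i; rewrite rowK; case: eqP => [->|_].
  by rewrite scalerN -scaleN1r; apply: NopenZ.
rewrite scalerDr; apply: NopenD => //; rewrite scalerA.
case: (leP (eps (G := G) s i k) 0) => _.
  by rewrite mulr0 scale0r; exists 0; rewrite ?mul0mx.
have heps : (eps (G := G) s i k)%:~R = form (row i s) (row k s) * (dd G k)%:R.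
  rewrite numqK // mulrC -[(dd G k)%:R]/((dd G k)%:Z%:~R) -formZr.
  apply: (int_all_ufopen hG) => //; exact/NufZ/huf.
have hz : form (row k s) (row i s) * (dd G i)%:R \is a Num.int.
  rewrite mulrC -[(dd G i)%:R]/((dd G i)%:Z%:~R) -formZr.
  by apply: (int_uf_open hG) => //; exact: huf.
(* The correction d_i {e_i, e_k} d_k e_k lies in N°: regrouped by skew-symmetry it is - ({e_k, e_i}
   d_i) times d_k e_k, and the bracket is an integer because e_k is in N_uf and d_i e_i in N°. *)
have -> : (dd G i)%:Z * eps (G := G) s i k =
          - numq (form (row k s) (row i s) * (dd G i)%:R) * (dd G k)%:Z.
  apply: (@intr_inj rat); rewrite !rmorphM rmorphN /= heps numqK // formC //.
  by rewrite !mulNr mulrN mulrCA mulrA.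
by rewrite -scalerA; apply: NopenZ.
Qed.

Lemma seed_like_at (w : vertex G) : seed_like (seed_at w).
Proof.
rewrite /seed_at; elim: w (seed0 G) seed_like0 => [//|k w IH] s hs /=.
by apply/IH/seed_like_mutate => //; exact: valP.
Qed.

Lemma dpairE s k m : seed_like s ->
  (dpair s k m)%:~R = (dd G k)%:R * pairing (row k s) (map_mx intr m) :> rat.
Proof.
move=> [_ _ ho]; rewrite numqK // -[(dd G k)%:R]/((dd G k)%:Z%:~R) -pairingZl.
have [y _ <-] := ho k; rewrite /pairing map_mxM mulmxK ?Nob_unit //.
by rewrite map_trmx -map_mxM mxE intr_int.
Qed.

(** Since {e_k, e_k} = 0, a tropical mutation preserves the very coordinate that determines its
    shift, so the shift can be recovered from the image and undone. *)
Lemma dpair_vvec s k (c : int) m : k \in uf G -> seed_like s ->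
  dpair s k (m + c *: vvec (G := G) s k) = dpair s k m.
Proof.
move=> kuf hs; apply: (@intr_inj rat); rewrite !dpairE // map_mxD pairingDr.
have [_ huf _] := hs.
by rewrite map_mxZ pairingZr pairing_pstar ?form_xx ?mulr0 ?addr0 //; apply: huf.
Qed.

Lemma trop_mut_inj s k : k \in uf G -> seed_like s ->
  injective (trop_mut (G := G) s k).
Proof.
move=> kuf hs m p; rewrite /trop_mut => e.
have h : dpair s k m = dpair s k p.
  by rewrite -[LHS](dpair_vvec (Num.max (dpair s k m) 0)) // e dpair_vvec.
by move: e; rewrite h => /addIr.
Qed.

Lemma trop_from_inj (w : vertex G) s : seed_like s -> injective (trop_from s w).
Proof.
elim: w s => [|k w IH] s hs //= m p /IH h.
have kuf := valP k.
by apply: (trop_mut_inj kuf hs); apply: h; exact: seed_like_mutate.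
Qed.

Lemma lsubmx_tropP_mut s k (x : 'rV[int]_(n + n)) :
  lsubmx (tropP_mut s k x) = trop_mut s k (lsubmx x).
Proof. by rewrite /tropP_mut linearD linearZ /= row_mxKl. Qed.

Lemma lsubmx_tropP (w : vertex G) (x : 'rV[int]_(n + n)) :
  lsubmx (tropP w x) = trop w (lsubmx x).
Proof.
rewrite /tropP /trop; elim: w (seed0 G) x => [|k w IH] s x //=.
by rewrite IH lsubmx_tropP_mut.
Qed.

Lemma tropP_mut_inj s k : k \in uf G -> seed_like s ->
  injective (tropP_mut (G := G) s k).
Proof.
move=> kuf hs x y e.
have h : lsubmx x = lsubmx y.
  by apply: (trop_mut_inj kuf hs); rewrite -!lsubmx_tropP_mut e.
by move: e; rewrite /tropP_mut h => /addIr.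
Qed.

Lemma tropP_mut_surj s k (y : 'rV[int]_(n + n)) : k \in uf G -> seed_like s ->
  exists x : 'rV[int]_(n + n), tropP_mut (G := G) s k x = y.
Proof.
move=> kuf hs; pose c := Num.max (dpair s k (lsubmx y)) 0.
have e : lsubmx (y - c *: vevec s k) = lsubmx y + (- c) *: vvec s k.
  by rewrite -scaleNr linearD linearZ /= row_mxKl.
by exists (y - c *: vevec s k); rewrite /tropP_mut e dpair_vvec // subrK.
Qed.

Lemma tropP_inj (w : vertex G) : injective (tropP w).
Proof.
rewrite /tropP; elim: w (seed0 G) seed_like0 => [|k w IH] s hs //= x y.
have kuf := valP k; move=> /(IH _ (seed_like_mutate kuf hs)).
exact: tropP_mut_inj.
Qed.

Lemma tropP_surj (w : vertex G) (y : 'rV[int]_(n + n)) :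
  exists x : 'rV[int]_(n + n), tropP w x = y.
Proof.
rewrite /tropP; elim: w (seed0 G) seed_like0 => [|k w IH] s hs /=; first by exists y.
have kuf := valP k; have [z <-] := IH _ (seed_like_mutate kuf hs).
by have [x <-] := tropP_mut_surj z kuf hs; exists x.
Qed.

End Seeds.

(** * Broken lines ending in the interior of a chamber *)

Section BrokenLines.
Context {k : fieldType} {R : realType} {G : cluster_data}.
Context (hG : is_fixed_data G).
Local Notation n := (rk G).
Context (s : 'M[int]_n) (D : set (wall k R n)).
Context (hs : seed_like s) (hD : forall W, D W -> is_wall s W).
Implicit Types (x : 'rV[int]_n) (m : 'rV[int]_(n + n)) (Q : 'rV[R]_(n + n)).
Implicit Type (b : bline k R G).

Lemma Nplus_unfold x : Nplus s x -> exists a : 'rV[int]_n,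
  [/\ x = a *m s, forall i, 0 <= a 0 i, forall i, i \notin uf G -> a 0 i = 0
    & exists2 i, i \in uf G & 0 < a 0 i].
Proof.
have [hu _ _] := hs; case=> h0 h1 h2; exists (x *m invmx s).
split => //; first by rewrite mulmxKV.
apply: contrapT => h; move: h2; rewrite big1 ?ltxx // => i _.
case iuf: (i \in uf G); last by rewrite h1 ?iuf.
apply/eqP; rewrite eq_le h0 andbT leNgt; apply/negP => ai.
by apply: h; exists i.
Qed.

Lemma Nplus_Nuf x : Nplus s x -> Nuf G x.
Proof.
move=> /Nplus_unfold[a [-> _ ha _]]; rewrite mulmx_sum_row.
have [_ huf _] := hs.
elim/big_ind : _ => [|u v|i _]; [exact: Nuf_sub0|exact: NufD|].
case iuf: (i \in uf G); last by rewrite ha ?iuf // scale0r; apply: Nuf_sub0.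
exact/NufZ/huf.
Qed.

Lemma NplusD x y : Nplus s x -> Nplus s y -> Nplus s (x + y).
Proof.
move=> [a0 a1 a2] [b0 b1 b2]; rewrite /Nplus /= mulmxDl; split=> [i|i iuf|].
- by rewrite mxE addr_ge0.
- by rewrite mxE a1 // b1.
- under eq_bigr do rewrite mxE.
  by rewrite big_split addr_gt0.
Qed.

Lemma NplusMn x j : (0 < j)%N -> Nplus s x -> Nplus s (x *+ j).
Proof.
case: j => // j _ hx; elim: j => [//|j IH]; rewrite mulrSr; exact: NplusD.
Qed.

Lemma Nplus_pairing_ge0 x (p : 'rV[R]_n) : Nplus s x ->
  (forall i, i \in uf G -> 0 <= pairing (row i s) p) -> 0 <= pairing x p.
Proof.
move=> /Nplus_unfold[a [-> ha h0 _]] hp; rewrite pairing_mulmx.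
apply: sumr_ge0 => i _; case iuf: (i \in uf G); last by rewrite h0 ?iuf ?mul0r.
by rewrite mulr_ge0 ?ler0z ?hp.
Qed.

Lemma Nplus_pairing_gt0 x Q : Nplus s x -> int_chamber s Q ->
  0 < pairing x (lsubmx Q).
Proof.
move=> /Nplus_unfold[a [-> ha h0 [i0 i0uf ai0]]] hQ; rewrite pairing_mulmx.
rewrite (bigD1 i0) //= ltr_pwDl //; first by rewrite mulr_gt0 ?ltr0z ?hQ.
apply: sumr_ge0 => i _; case iuf: (i \in uf G); last by rewrite h0 ?iuf ?mul0r.
by rewrite mulr_ge0 ?ler0z // ltW ?hQ.
Qed.

Lemma chamber_real (m : 'rV[int]_n) i : chamber s m -> i \in uf G ->
  0 <= pairing (row i s) (map_mx intr m : 'rV[R]_n).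
Proof. by move=> hm iuf; rewrite pairing_ratr ler0q; exact: hm. Qed.

Lemma int_chamber_support Q : int_chamber s Q -> ~ support D Q.
Proof.
move=> hQ [W /hD hW] /(wall_perp hW) /eqP; apply/negP.
by rewrite gt_eqF // Nplus_pairing_gt0 //; exact: wall_Nplus.
Qed.

Lemma singular_support : singular D `<=` support D.
Proof. by move=> p [[W DW [Wp _]]|[W [W' [d [DW _ _ _ [Wp _]]]]]]; exists W. Qed.

Lemma int_chamber_ray Q m (c : R) : int_chamber s Q -> chamber s (lsubmx m) ->
  0 <= c -> int_chamber s (Q + c *: map_mx intr m).
Proof.
move=> hQ hm c0 i iuf; rewrite linearD linearZ /= -map_lsubmx pairingDr pairingZr.
by rewrite ltr_pwDl ?hQ // mulr_ge0 ?chamber_real.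
Qed.

Lemma straight_broken_line Q m0 : m0 != 0 -> chamber s (lsubmx m0) ->
  int_chamber s Q -> broken_lines D m0 Q [:: (0, 1, m0)].
Proof.
move=> m00 hm hQ; split=> //; first exact: int_chamber_support.
exists (fun t => Q + (- t) *: map_mx intr m0); split=> //.
- by rewrite oppr0 scale0r addr0.
- move=> [|//] t _ _ _; rewrite /btime /bexp /= oppr0 scale0r addr0 sub0r //.
- move=> t t0 /singular_support; apply: int_chamber_support.
  by apply: int_chamber_ray; rewrite ?oppr_ge0.
Qed.

Lemma broken_line_unbent Q m0 b : broken_lines D m0 Q b -> size b = 1%N ->
  b = [:: (0, 1, m0)].
Proof.
case: b => [|[[t c] m] [|? ?]] //= [_ _ _ [+ + +] _] _.
by rewrite /btime /bcoef /bexp /= => -> -> ->.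
Qed.

(** Domain i+1 begins where domain i ends, so its linear formula can be evaluated at its initial
    time. *)
Lemma broken_line_step b (g : R -> 'rV[R]_(n + n)) i :
  (forall i t, (i < size b)%N -> (0 < i)%N ==> (btime b i.-1 <= t) -> t <= btime b i ->
            g t = g (btime b i) + (btime b i - t) *: map_mx intr (bexp b i)) ->
  sorted (fun u v : R * k * 'rV[int]_(n + n) => u.1.1 < v.1.1) b ->
  (i.+1 < size b)%N ->
  btime b i < btime b i.+1 /\
  g (btime b i) = g (btime b i.+1) +
    (btime b i.+1 - btime b i) *: map_mx intr (bexp b i.+1).
Proof.
move=> hg /(sortedP (0, 0, 0)) hb hi; have ht := hb i hi.
by split=> //; apply: hg => //=; rewrite ?lexx // ltW.
Qed.

(* Going backwards in time from [Q] the line follows its final exponent, hence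
   stays inside the chamber, where there is no wall to bend at. *)
Lemma final_exponent_unbent Q m0 b : int_chamber s Q -> broken_lines D m0 Q b ->
  chamber s (lsubmx (bexp b (size b).-1)) -> size b = 1%N.
Proof.
move=> hQ [_ _ [b0 hb] [tb _ _] [g [g0 hg _ hbend]]] hm.
case sb: (size b) b0 hm tb => [|[|i]] //= _ hm tb; exfalso.
have hi : (i.+1 < size b)%N by rewrite sb.
have [ht hgi] := broken_line_step hg hb hi.
have [x [j /= [[W [DW]] + _ _ _]]] := hbend i hi.
rewrite hgi tb g0 => hW.
have : support D (Q + (0 - btime b i) *: map_mx intr (bexp b i.+1)).
  by exists W.
apply: int_chamber_support; apply: int_chamber_ray => //.
by rewrite sub0r oppr_ge0 -tb ltW.
Qed.

(* Writing the exponents as m_i = m_0 + p^*(N_i), the function t |-> <N_i, g t>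
   is continuous, because N_i only changes by a multiple of the normal of the
   wall being crossed, starts at 0, and has slope - <N_i, m_0> <= 0 since
   {N_i, N_i} = 0. *)
Lemma broken_line_moment (m0 : 'rV[int]_(n + n)) b (g : R -> 'rV[R]_(n + n)) :
  chamber s (lsubmx m0) -> bexp b 0 = m0 ->
  sorted (fun u v : R * k * 'rV[int]_(n + n) => u.1.1 < v.1.1) b ->
  (forall i t, (i < size b)%N -> (0 < i)%N ==> (btime b i.-1 <= t) -> t <= btime b i ->
            g t = g (btime b i) + (btime b i - t) *: map_mx intr (bexp b i)) ->
  (forall i, (i.+1 < size b)%N ->
     bends D (g (btime b i)) (bcoef b i) (bexp b i) (bcoef b i.+1) (bexp b i.+1)) ->
  forall i, (i < size b)%N -> exists x,
    [/\ x = 0 \/ Nplus s x, (0 < i)%N -> Nplus s x, bexp b i = m0 + pvec x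
      & pairing x (lsubmx (g (btime b i))) <= 0].
Proof.
move=> hm bm hb hg hbend; elim=> [_|i IH hi].
  by exists 0; rewrite (pvec0 hG) addr0 pairing0l; split=> //; left.
have [x [x0 _ bx px]] := IH (ltnW hi).
have [y [j /= [[W [DW Wp]] hWy [_ j0] [_ _ by']]]] := hbend i hi.
have yE := hWy W (conj DW Wp).
have hy : Nplus s y by rewrite -yE; exact/wall_Nplus/hD.
have py : pairing y (lsubmx (g (btime b i))) = 0.
  by rewrite -yE; apply: (wall_perp (hD DW)).
have xuf : Nuf G x by case: x0 => [->|/Nplus_Nuf//]; exact: Nuf_sub0.
have hN : Nplus s (x + y *+ j).
  by case: x0 => [->|hx]; rewrite ?add0r; [|apply: NplusD => //]; exact: NplusMn.
have bN : bexp b i.+1 = m0 + pvec (x + y *+ j).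
  by rewrite by' bx (pvecD hG) ?(pvecMn hG) ?addrA //;
      [exact: Nplus_Nuf|exact/NufMn/Nplus_Nuf].
exists (x + y *+ j); split=> //; first by right.
have [ht hgi] := broken_line_step hg hb hi.
have := px; rewrite -[pairing x _]addr0 -(mul0rn _ j) -py -pairingMnl -pairingDl hgi.
rewrite linearD linearZ /= pairingDr pairingZr => h; apply: le_trans h.
rewrite lerDl mulr_ge0 ?subr_ge0 ?(ltW ht) // -map_lsubmx bN linearD map_mxD pairingDr.
rewrite (pairing_pvec hG) ?addr0; last exact: Nplus_Nuf.
by apply: Nplus_pairing_ge0 => // l luf; apply: chamber_real.
Qed.

Lemma initial_exponent_unbent Q m0 b : int_chamber s Q -> broken_lines D m0 Q b ->
  chamber s (lsubmx m0) -> size b = 1%N.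
Proof.
move=> hQ [_ _ [b0 hb] [tb _ bm] [g [g0 hg _ hbend]]] hm.
have := broken_line_moment hm bm hb hg hbend.
(* If there were a bend, the last domain would have N in N^+ and end at Q, forcing <N, Q> <= 0
   inside the chamber. *)
case sb: (size b) b0 tb => [|[|i]] //= _ tb /(_ i.+1 (ltnSn _)) [x [_ /(_ isT) hx _]].
by rewrite tb g0 leNgt Nplus_pairing_gt0.
Qed.

Lemma broken_lines_initial Q m0 : m0 != 0 -> int_chamber s Q ->
  chamber s (lsubmx m0) -> broken_lines D m0 Q = [set [:: (0, 1, m0)]].
Proof.
move=> m00 hQ hm; apply/seteqP; split=> [b hb|b ->]; last exact: straight_broken_line.
by apply: (broken_line_unbent hb); apply: initial_exponent_unbent hb hm.
Qed.

Lemma finite_broken_lines_initial Q m0 : int_chamber s Q ->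
  chamber s (lsubmx m0) -> finite_set (broken_lines D m0 Q).
Proof.
move=> hQ hm; have [->|m00] := eqVneq m0 0; last by rewrite broken_lines_initial.
(* A broken line has non-zero initial exponent by definition. *)
rewrite (_ : broken_lines D 0 Q = set0) //; apply/seteqP; split=> // b [].
by rewrite eqxx.
Qed.

Lemma theta_at_initial Q m0 m : int_chamber s Q -> chamber s (lsubmx m0) ->
  theta_at D Q m0 m = (m == m0)%:R.
Proof.
move=> hQ hm; rewrite /theta_at; case: eqVneq => [->//|m00].
rewrite broken_lines_initial //; have [->|mm] := eqVneq m m0.
  rewrite (_ : [set b | _] = [set [:: (0, 1, m0)]]) ?fsbig_set1 //.
  by apply/seteqP; split=> [b []//|b ->].
rewrite (_ : [set b | _] = set0) ?fsbig_set0 //; apply/seteqP; split=> // b [] ->.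
by rewrite /bexp /= => e; rewrite e eqxx in mm.
Qed.

Lemma theta_at_final Q m0 m : int_chamber s Q -> chamber s (lsubmx m) ->
  theta_at D Q m0 m = (m0 == m)%:R.
Proof.
move=> hQ hm; rewrite /theta_at; case: eqVneq => [->|m00]; first by rewrite eq_sym.
have [e|mm] := eqVneq m0 m.
  subst m0; rewrite broken_lines_initial //.
  rewrite (_ : [set b | _] = [set [:: (0, 1, m)]]) ?fsbig_set1 //.
  by apply/seteqP; split=> [b []//|b ->].
rewrite (_ : [set b | _] = set0) ?fsbig_set0 //; apply/seteqP; split=> // b [hb bm].
have sb : size b = 1%N by apply: (final_exponent_unbent hQ hb); rewrite bm.
move: bm; rewrite (broken_line_unbent hb sb) /bexp /= => e.
by rewrite e eqxx in mm.
Qed.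

End BrokenLines.

(** * Existence of general points in chamber interiors *)

Section GeneralPoints.
Context {R : realType}.

(** Countable sets have Lebesgue measure zero, whereas the open unit interval has measure one. *)
Lemma positive_notin_countable (A : set R) : countable A -> exists2 x, 0 < x & ~ A x.
Proof.
move=> cA; apply: contrapT => h.
have sA : `]0, 1[ `<=` A.
  move=> x /=; rewrite in_itv /= => /andP[x0 _].
  by apply: contrapT => nA; apply: h; exists x.
have := countable_lebesgue_measure0 (sub_countable (subset_card_le sA) cA).
by rewrite lebesgue_measure_itv /= lte_fin ltr01 oppr0 adde0 => /eqP; rewrite onee_eq0.
Qed.

(** Coordinates are added one at a time, each avoiding the countably many values that would create
    an integral relation with the earlier ones. *)
Lemma exists_int_free m : exists u : 'rV[R]_m, (forall i, 0 < u 0 i) /\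
  forall a : 'rV[int]_m, a != 0 -> \sum_i (a 0 i)%:~R * u 0 i != 0.
Proof.
elim: m => [|m [u [u0 hu]]].
  by exists 0; split=> [[]//|a]; rewrite thinmx0 eqxx.
(* For [p.2 != 0] this is the only value of the new coordinate satisfying the relation with
   coefficients p; for [p.2 = 0] it is 0, which a positive x avoids anyway. *)
pose f (p : 'rV[int]_m * int) : R := - (\sum_i (p.1 0 i)%:~R * u 0 i) / p.2%:~R.
have [x x0 hx] : exists2 x, 0 < x & ~ range f x.
  apply: positive_notin_countable.
  by apply: sub_countable (card_image_le _ _) _; exact: countableP.
exists (\row_i (if unlift ord0 i is Some j then u 0 j else x)); split=> [i|a a0].
  by rewrite mxE; case: unliftP.
rewrite big_ord_recl mxE unlift_none; set S := (X in _ + X).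
have SE : S = \sum_i ((\row_j a 0 (lift ord0 j)) 0 i)%:~R * u 0 i.
  by apply: eq_bigr => i _; rewrite !mxE liftK.
have [a00|a00] := eqVneq (a 0 ord0) 0.
  rewrite a00 mul0r add0r SE; apply: hu; apply: contra_neq a0 => e.
  apply/rowP => i; rewrite mxE; case: (unliftP ord0 i) => [j|] -> //.
  by have /rowP/(_ j) := e; rewrite !mxE.
apply/eqP => e; apply: hx; exists (\row_j a 0 (lift ord0 j), a 0 ord0) => //=.
rewrite /f /= -SE; have /eqP := e; rewrite addr_eq0 => /eqP <-.
by rewrite mulrC mulKf // intr_eq0.
Qed.

(** An integrally free positive vector u is moved into the chamber by an integral matrix of non-zero
    determinant, which sends non-zero integral relations to non-zero ones. *)
Lemma exists_general (G : cluster_data) (s : 'M[int]_(rk G)) :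
  is_fixed_data G -> s \in unitmx ->
  exists Q : 'rV[R]_(rk G + rk G), general Q /\ int_chamber s Q.
Proof.
move=> hG su; have [u [u0 hu]] := exists_int_free (rk G + rk G).
(* With this B, the M°-part of u B^T pairs with e_i to the i-th coordinate of u; unimodularity of s
   keeps B integral. *)
pose B := block_mx (Nob G *m invmx s) 0 0 (1%:M : 'M[int]_(rk G)).
have dB : \det B != 0.
  rewrite det_ublock det1 mulr1 det_mulmx mulf_neq0 ?(Nob_index hG) //.
  by have := su; rewrite -unitmx_inv unitmxE; apply: contraTneq => ->; rewrite unitr0.
exists (u *m (map_mx intr B)^T); split=> [a a0|i iuf].
  have aB : a *m B != 0.
    apply: contra_neq a0 => e; have : a *m B *m \adj B = 0 by rewrite e mul0mx.
    rewrite -mulmxA mul_mx_adj mul_mx_scalar => /eqP.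
    by rewrite scalemx_eq0 (negPf dB) => /eqP.
  suff -> : \sum_i (a 0 i)%:~R * (u *m (map_mx intr B)^T) 0 i =
            \sum_i ((a *m B) 0 i)%:~R * u 0 i by exact: hu.
  transitivity ((map_mx intr a *m (u *m (map_mx intr B)^T)^T) 0 0).
    rewrite [RHS]mxE; apply: eq_bigr => i _.
    by rewrite [in RHS]mxE [in X in _ = _ * X]mxE.
  rewrite trmx_mul trmxK mulmxA -map_mxM [LHS]mxE.
  by apply: eq_bigr => i _; rewrite mxE [in X in _ * X = _]mxE.
rewrite /pairing -(hsubmxK u) map_block_mx tr_block_mx mul_row_block row_mxKl.
rewrite map_mx0 trmx0 mulmx0 addr0 trmx_mul trmxK map_mxM !mulmxA mulmxKV ?Nob_unit //.
rewrite -map_mxM -row_mul mulmxV // row1 map_delta_mx -rowE mxE mxE mxE.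
exact: u0.
Qed.

End GeneralPoints.

(** * Linear independence of characters and of their images under mutation *)

Section Characters.
Context {k : fieldType} {m : nat}.
Implicit Types (x y v : 'rV[int]_m) (c : k).
Local Notation chi := (@character k m).
Local Notation cst c := (tofrac (mpolyC m c : mpoly m k) : ratfun k m).

Lemma mpolyX_neq0 (i : 'I_m) : tofrac (mpolyX k (mnm1 i) : mpoly m k) != 0.
Proof.
rewrite tofrac_eq0; apply/eqP => /(congr1 (mcoeff (mnm1 i))).
by move=> /eqP; rewrite mcoeffX eqxx mcoeff0 oner_eq0.
Qed.

Lemma characterD x y : chi (x + y) = chi x * chi y.
Proof.
rewrite -big_split; apply: eq_bigr => i _.
by rewrite mxE expfzDr // mpolyX_neq0.
Qed.

Lemma character0 : chi 0 = 1.
Proof. by apply: big1 => i _; rewrite mxE expr0z. Qed.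

Lemma characterMn x j : chi (x *+ j) = chi x ^+ j.
Proof.
elim: j => [|j IH]; first by rewrite mulr0n character0.
by rewrite mulrSr characterD IH exprSr.
Qed.

Lemma character_nonneg x : (forall i, 0 <= x 0 i) ->
  chi x = tofrac (mpolyX k (Multinom [tuple `|x 0%R i|%N | i < m])).
Proof.
move=> x0; rewrite mpolyXE_id rmorph_prod; apply: eq_bigr => i _.
by rewrite rmorphXn mnmE /= exprnP gez0_abs.
Qed.

(** Multiplication by a large monomial turns the relation into one between polynomials, where
    coefficients are compared. Indexing by a sequence allows repeated exponents, as arise from
    expanding powers of 1 + z^v. *)
Lemma character_indep (I : eqType) (r : seq I) (c : I -> k) (x : I -> 'rV[int]_m) :
  \sum_(i <- r) cst (c i) * chi (x i) = 0 ->
  forall y, \sum_(i <- r | x i == y) c i = 0.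
Proof.
move=> h y.
(* The exponent y is included because it need not occur among the x i, yet its shift must also be a
   monomial. *)
have [N hN] : exists N : nat,
    forall z, z \in y :: map x r -> forall i, 0 <= (z + const_mx N%:Z) 0 i.
  exists (\max_(z <- y :: map x r) \max_i `|z 0%R i|)%N => z zr i.
  rewrite !mxE -lerBlDl sub0r; apply: (@le_trans _ _ `|z 0 i|%:Z).
    by rewrite abszE -normrN ler_norm.
  rewrite lez_nat; apply: leq_trans (leq_bigmax_seq _ zr isT).
  by rewrite (bigD1 i) //= leq_maxl.
pose mn z := Multinom [tuple absz ((z + const_mx N%:Z : 'rV[int]_m) 0 i) | i < m].
have mn_inj z : z \in y :: map x r -> (mn z == mn y) = (z == y).
  move=> zr; apply/eqP/eqP => [|-> //] /mnmP e; apply: (addIr (const_mx N%:Z)).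
  apply/rowP => i; have := e i; rewrite !mnmE => e'.
  rewrite -[LHS]gez0_abs ?(hN z) // -[RHS]gez0_abs ?(hN y) ?inE ?eqxx //.
  by rewrite e'.
have : (\sum_(i <- r) (mpolyC m (c i) * mpolyX k (mn (x i)))) = 0 :> mpoly m k.
  apply/eqP; rewrite -tofrac_eq0 rmorph_sum /=; apply/eqP.
  transitivity ((\sum_(i <- r) cst (c i) * chi (x i)) * chi (const_mx N%:Z)).
    2: by rewrite h mul0r.
  rewrite mulr_suml big_seq [RHS]big_seq; apply: eq_bigr => i ir.
  rewrite rmorphM /= -mulrA -characterD character_nonneg //.
  by apply: hN; rewrite inE map_f ?orbT.
move=> /(congr1 (mcoeff (mn y))); rewrite mcoeff0 raddf_sum /= => h0.
rewrite -[RHS]h0 big_mkcond big_seq [RHS]big_seq; apply: eq_bigr => i ir.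
rewrite mcoeffCM mcoeffX mn_inj; last by rewrite inE map_f ?orbT.
by case: eqP; rewrite ?mulr1 ?mulr0.
Qed.

Lemma character_fset_indep (T : {fset 'rV[int]_m}) (c : 'rV[int]_m -> k) :
  \sum_(x <- T) cst (c x) * chi x = 0 -> forall x, x \in T -> c x = 0.
Proof.
move=> /character_indep h x xT; have := h x.
by rewrite -big_filter filter_pred1_uniq ?fset_uniq // big_seq1.
Qed.

Lemma add1_character_neq0 v : v != 0 -> 1 + chi v != 0.
Proof.
move=> v0; apply/eqP => e.
have := @character_indep _ [:: v; 0] (fun=> 1) id _ 0.
rewrite !big_cons !big_nil /= (negPf v0) eqxx !addr0 mpolyC1 rmorph1 !mul1r.
by rewrite character0 addrC => /(_ e) /eqP; rewrite oner_eq0.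
Qed.

(* After clearing denominators only terms z^(x + l v), l >= 0, arise from x; so
   a point of the support that is minimal in the direction of v receives no
   contribution from the others. *)
Lemma twisted_character_indep v (e : 'rV[int]_m -> int) (T : {fset 'rV[int]_m})
    (c : 'rV[int]_m -> k) : v != 0 ->
  \sum_(x <- T) cst (c x) * (chi x * (1 + chi v) ^ e x) = 0 ->
  forall x, x \in T -> c x = 0.
Proof.
move=> v0 h x xT; apply: contrapT => /eqP cx.
(* Euclidean product with v: the height in the direction of v. *)
pose u (z : 'rV[int]_m) : int := (z *m v^T) 0 0.
have uD z l : u (z + v *+ l) = u z + u v *+ l.
  by rewrite /u mulmxDl mxE -scaler_nat -scalemxAl [X in _ + X]mxE mulr_natl.
have uv : 0 < u v.
  rewrite /u mxE; under eq_bigr do rewrite mxE -expr2.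
  rewrite lt_neqAle sumr_ge0 ?andbT; last by move=> i _; exact: sqr_ge0.
  apply: contra_neq v0 => /esym/psumr_eq0P h0; apply/rowP => i.
  by apply/eqP; rewrite mxE -sqrf_eq0 h0 // => j _; exact: sqr_ge0.
have [[y yT] /= cy ymin] :=
  @arg_minP _ _ T [` xT]%fset (fun i => c (val i) != 0) (u \o val) cx.
(* The power N of 1 + z^v clears all denominators, leaving exponents [E z]. *)
pose N := (\max_(z <- T) `|e z|)%N.
pose E z := absz (N%:Z + e z).
have hE z : z \in T -> E z = N%:Z + e z :> int.
  move=> zT; rewrite /E gez0_abs // -lerBlDl sub0r lerNl.
  apply: (@le_trans _ _ `|e z|%:Z); first by rewrite abszE -normrN ler_norm.
  by rewrite lez_nat (leq_bigmax_seq _ zT isT).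
(* A bound common to all z makes the expansion a sum over a product; binomials beyond [E z]
   vanish. *)
pose L := (\max_(z <- T) E z)%N.
have hL z : z \in T -> (E z <= L)%N by move=> zT; rewrite (leq_bigmax_seq _ zT isT).
have w0 := add1_character_neq0 v0.
have pow z : z \in T -> (1 + chi v) ^ e z * (1 + chi v) ^+ N =
    \sum_(l <- iota 0 L.+1) cst ('C(E z, l)%:R) * chi (v *+ l).
  move=> zT; rewrite exprnP -expfzDr // [e z + _]addrC -hE // -exprnP exprDn.
  rewrite -(big_mkord xpredT (fun l => (1 ^+ (E z - l) * chi v ^+ l) *+ 'C(E z, l))).
  rewrite (big_nat_widen _ _ L.+1) ?ltnS ?hL // big_mkcond /=.
  rewrite /index_iota subn0; apply: eq_bigr => l _.
  rewrite characterMn expr1n mul1r ltnS mpolyC_nat rmorph_nat mulr_natl.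
  by case: leqP => // lE; rewrite bin_small.
have : \sum_(p <- [seq (z, l) | z <- T, l <- iota 0 L.+1])
         cst (c p.1 * 'C(E p.1, p.2)%:R) * chi (p.1 + v *+ p.2) = 0.
  rewrite big_allpairs /=.
  transitivity ((\sum_(x <- T) cst (c x) * (chi x * (1 + chi v) ^ e x)) *
                (1 + chi v) ^+ N).
    2: by rewrite h mul0r.
  rewrite mulr_suml big_seq [RHS]big_seq; apply: eq_bigr => z zT.
  rewrite -!mulrA pow // !mulr_sumr; apply: eq_bigr => l _.
  by rewrite mpolyCM rmorphM characterD -!mulrA; congr (_ * _); apply: mulrCA.
(* At z^y the pair (y, 0) contributes c y, and (y, l) with l > 0 lies strictly higher. *)
move=> /character_indep/(_ y); rewrite big_mkcond big_allpairs /=.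
rewrite (bigD1_seq y) //= big_cons mulr0n addr0 eqxx bin0 mulr1.
rewrite big1_seq ?addr0; last first.
  move=> l; rewrite mem_iota => /andP[_ /andP[l0 _]]; case: eqP => // /(congr1 u).
  move=> /eqP; rewrite uD addrC -subr_eq0 addrK mulrn_eq0 (gt_eqF uv) orbF.
  by rewrite -leqn0 leqNgt l0.
(* Another z reaching y = z + l v has l > 0, so it lies strictly below y and has c z = 0 by
   minimality. *)
rewrite big1_seq ?addr0; first by move=> cy0; rewrite cy0 eqxx in cy.
move=> z /andP[zy zT]; rewrite big1 // => l _; case: eqP => // zl.
have [l0|l0] := posnP l; first by rewrite -zl l0 mulr0n addr0 eqxx in zy.
suff -> : c z = 0 by rewrite mul0r.
apply: contrapT => /eqP cz; have /= := ymin [` zT]%fset cz.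
by rewrite -zl uD leNgt ltrDl pmulrn_lgt0 // uv.
Qed.

(** Two functions may have different supports; summing both over the union reduces injectivity to
    independence. *)
Lemma lineval_inj (phi : 'rV[int]_m -> ratfun k m) :
  (forall (T : {fset 'rV[int]_m}) (c : 'rV[int]_m -> k),
     \sum_(x <- T) cst (c x) * phi x = 0 -> forall x, x \in T -> c x = 0) ->
  injective (lineval phi).
Proof.
move=> hphi f g.
have wide (f' : laurent k m) (T : {fset 'rV[int]_m}) : (finsupp f' `<=` T)%fset ->
    lineval phi f' = \sum_(x <- T) cst (f' x) * phi x.
  move=> sT; apply: big_fset_incl => // x xT xf.
  by rewrite fsfun_dflt // mpolyC0 rmorph0 mul0r.
pose T := (finsupp f `|` finsupp g)%fset.
rewrite !(wide _ T) ?fsubsetUl ?fsubsetUr // => /eqP.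
rewrite -subr_eq0 -sumrB => /eqP h.
apply/fsfunP => x; have [xT|] := boolP (x \in T); last first.
  by rewrite inE negb_or => /andP[xf xg]; rewrite !fsfun_dflt.
apply/eqP; rewrite -subr_eq0; apply/eqP; apply: (hphi T (fun x => f x - g x)) xT.
rewrite -[RHS]h; apply: eq_bigr => z _.
by rewrite mpolyCB rmorphB mulrBl.
Qed.

End Characters.

(** * Global functions on A_prin are determined on one torus *)

Section GlobalFunctions.
Context {k : fieldType} {G : cluster_data} (hG : is_fixed_data G).
Local Notation n := (rk G).

Lemma vevec_neq0 (s : 'M[int]_n) j : s \in unitmx -> vevec s j != 0.
Proof.
move=> su; apply/eqP => /(congr1 rsubmx); rewrite row_mxKr linear0 => e.
have : row j (s *m invmx s) = 0 by rewrite row_mul e mul0mx.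
by rewrite mulmxV // => /rowP/(_ j)/eqP; rewrite !mxE eqxx oner_eq0.
Qed.

(** Across each edge of the mutation tree agreement passes both ways: away from the root by
    independence of mutated characters, towards it by independence of characters. Every vertex is
    thus linked to the root. *)
Lemma up_prin_eq (F F' : torus_family k G) w :
  up_prin F -> up_prin F' -> F w = F' w -> F = F'.
Proof.
move=> hF hF'.
have step w' j : F w' = F' w' <-> F (rcons w' j) = F' (rcons w' j).
  have chi_inj := lineval_inj (@character_fset_indep k (n + n)).
  have su : seed_at w' \in unitmx by have [] := seed_like_at hG w'.
  have mut_inj := lineval_inj (fun T c => @twisted_character_indep k (n + n)
    (vevec (seed_at w') (val j)) (fun x => - dpair (seed_at w') (val j) (lsubmx x)) T c
    (vevec_neq0 (val j) su)).
  split=> e; [apply: mut_inj|apply: chi_inj]; last by rewrite (hF w' j) (hF' w' j) e.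
  exact: etrans (esym (hF w' j)) (etrans (congr1 _ e) (hF' w' j)).
have root w' : F w' = F' w' <-> F [::] = F' [::].
  by elim/last_ind: w' => [//|w' j IH]; rewrite -step.
by move=> /root e; apply/funext => w'; apply/root.
Qed.

End GlobalFunctions.

Theorem theorem7p20 (k : fieldType) (R : realType) (G : cluster_data)
    (hk : [pchar k] =i pred0) (hG : is_fixed_data G)
    (D : vertex G -> set (wall k R (rk G)))
    (hD : forall w, is_cluster_diagram (seed_at w) (D w))
    (theta : 'rV[int]_(rk G + rk G) -> torus_family k G)
    (htheta : forall q, Theta_prin D q -> is_theta D q (theta q)) :
  (forall (lift : 'rV[int]_(rk G) -> 'rV[int]_(rk G + rk G))
          (alpha : {fsfun 'rV[int]_(rk G) -> k with 0}),
     (forall q, Theta_A D q -> Theta_prin D (lift q) /\ rhoT (lift q) = q) ->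
     (forall q, q \in finsupp alpha -> Theta_A D q) ->
     (forall w m,
        \sum_(q <- finsupp alpha) alpha q * resA (theta (lift q)) w m = 0) ->
     forall q, DeltaPlus G q -> alpha q = 0) /\
  (forall (r : nat) (F : 'I_r -> torus_family k G) (alpha : 'I_r -> k),
     injective F -> (forall i, cluster_monomial_prin (F i)) ->
     (forall w x, \sum_(i < r) alpha i * F i w x = 0) ->
     forall i, alpha i = 0).
Proof.
have hwall w W : D w W -> is_wall (seed_at w) W.
  by have [[hW _] _ _ _] := hD w; exact: hW.
have hs w := seed_like_at hG w.
have theta_final q w x : Theta_prin D q -> chamber (seed_at w) (lsubmx x) ->
    theta q w x = (tropP w q == x)%:R.
  move=> /htheta [_ hq] hx; have [su _ _] := hs w.
  have [Q [gQ iQ]] := @exists_general R G _ hG su.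
  have [_ ->] := hq w Q gQ iQ.
  exact: (theta_at_final hG (hs w) (@hwall w) _ iQ hx).
split=> [lift alpha hlift hsupp hrel q [w hq]|r F alpha injF hF hrel i].
  apply: contrapT => /eqP aq; have qT : q \in finsupp alpha by rewrite mem_finsupp.
  (* The relation is read on the torus of w, where q lies in the chamber. *)
  have := hrel w (trop w q); rewrite (bigD1_seq q) ?fset_uniq //=.
  have res q' : q' \in finsupp alpha ->
      resA (theta (lift q')) w (trop w q) = (q' == q)%:R.
    move=> /hsupp/hlift[hl el]; rewrite /resA.
    (* All exponents over [trop w q] lie in the chamber, so [theta_final] evaluates every summand of
       [resA], and only t can contribute. *)
    set t := tropP w (lift q').
    have lt : lsubmx t = trop w q' by rewrite lsubmx_tropP -/(rhoT _) el.
    have [e|ne] := eqVneq q' q.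
      have ct : chamber (seed_at w) (lsubmx t) by rewrite lt e.
      rewrite big_mkcond (bigD1_seq t) ?fset_uniq //=; last first.
        by rewrite mem_finsupp theta_final // eqxx oner_neq0.
      rewrite {1}lt {1}e eqxx theta_final // eqxx big1 ?addr0 // => x xt.
      by case: eqP => // lx; rewrite theta_final ?lx // eq_sym (negPf xt).
    rewrite big1 // => x /eqP lx; rewrite theta_final ?lx //; case: eqP => // tx.
    case/eqP: ne; apply: (@trop_from_inj _ hG w _ (seed_like0 hG)).
    by rewrite -/(trop w q') -/(trop w q) -lt -lx -tx.
  rewrite res // eqxx mulr1 big1_seq ?addr0; first by move/eqP; rewrite (negPf aq).
  by move=> q' /andP[/negPf nq q'T]; rewrite res // nq mulr0.
pose wx j := cid (proj2 (hF j)); pose w j := projT1 (wx j).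
pose x j := projT1 (cid (projT2 (wx j))).
have hx j : chamber (seed_at (w j)) (lsubmx (x j)) /\
            forall y, F j (w j) y = (y == x j)%:R.
  exact: projT2 (cid (projT2 (wx j))).
(* The g-vector of F j, transported back to the chart of the initial seed. *)
pose q j := projT1 (cid (tropP_surj hG (w j) (x j))).
have qE j : tropP (w j) (q j) = x j by exact: projT2 (cid (tropP_surj hG (w j) (x j))).
have hq j : Theta_prin D (q j).
  exists (w j) => Q _ iQ; rewrite qE; have [cx _] := hx j.
  exact: (finite_broken_lines_initial hG (hs (w j)) (@hwall (w j)) iQ cx).
have FE j : F j = theta (q j).
  have [up hj] := htheta _ (hq j); have [cx Fx] := hx j; have [upF _] := hF j.
  apply: (up_prin_eq hG (w := w j) upF up); apply/fsfunP => y; rewrite Fx.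
  have [su _ _] := hs (w j); have [Q [gQ iQ]] := @exists_general R G _ hG su.
  have [_ ->] := hj (w j) Q gQ iQ; rewrite qE.
  by rewrite (theta_at_initial hG (hs (w j)) (@hwall (w j)) _ iQ cx).
(* On the torus where F i is the character with exponent x i, another F j contributes only if it has
   the same g-vector; then F j = F i by [FE], against injectivity of F. *)
have := hrel (w i) (x i); rewrite (bigD1 i) //= big1 ?addr0.
  by have [_ ->] := hx i; rewrite eqxx mulr1.
move=> j ji; rewrite FE theta_final //; last by have [] := hx i.
rewrite -qE (inj_eq (@tropP_inj _ hG (w i))); case: eqP => [e|_]; last by rewrite mulr0.
by move: ji; rewrite -(inj_eq injF) !FE e eqxx.
Qed.
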